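(* Let $\kappa$ be an uncountable cardinal with $\kappa=\kappa^{<\kappa}$. Assume that every $\mathbf{\Sigma}^1_1$ subset of ${}^\kappa\kappa$ satisfies the Hurewicz dichotomy. (1) If $\kappa$ is not weakly compact, then all $\mathbf{\Sigma}^1_1$ and all $\mathbf{\Pi}^1_1$ subsets of ${}^\kappa\kappa$ are $\kappa$-Sacks measurable. (2) If $\kappa$ is weakly compact, then all $\mathbf{\Sigma}^1_1$ and all $\mathbf{\Pi}^1_1$ subsets of ${}^\kappa\kappa$ are $\kappa$-Miller measurable.
   Context: ${}^\kappa\kappa$ is the set of all functions from $\kappa$ to $\kappa$ with the bounded topology, whose basic open sets are $N_s=\{x\in{}^\kappa\kappa \mid s\subseteq x\}$ for $s\in{}^{<\kappa}\kappa$ (functions from an ordinal ${<}\kappa$ into $\kappa$). A subset of ${}^\kappa\kappa$ is $\mathbf{\Sigma}^1_1$ if it is the projection to the first coordinate of a closed subset of ${}^\kappa\kappa\times{}^\kappa\kappa$ (product topology), and $\mathbf{\Pi}^1_1$ if its complement is $\mathbf{\Sigma}^1_1$. $A\subseteq{}^\kappa\kappa$ is $\kappa$-compact if every open cover of $A$ has a subcover of size less than $\kappa$, and $\mathrm{K}_\kappa$ if it is a union of $\kappa$-many $\kappa$-compact subsets of ${}^\kappa\kappa$. $A\subseteq{}^\kappa\kappa$ satisfies the Hurewicz dichotomy if either $A$ is contained in a $\mathrm{K}_\kappa$ subset of ${}^\kappa\kappa$, or else $A$ contains a closed subset of ${}^\kappa\kappa$ homeomorphic to ${}^\kappa\kappa$.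 A subtree of ${}^{<\kappa}\kappa$ is a subset closed under initial segments; $[T]=\{x\in{}^\kappa\kappa\mid \forall\alpha<\kappa\ (x\restriction\alpha\in T)\}$. A subtree $T$ is superclosed if it is closed under unions of increasing sequences of length ${<}\kappa$. A (nonempty) superclosed subtree $T$ is perfect (respectively, a $\kappa$-Miller tree) if every $t\in T$ is extended by some $s\in T$ which has at least $2$ (respectively, at least $\kappa$-many) immediate successors in $T$. A set $A\subseteq{}^\kappa\kappa$ is $\kappa$-Sacks measurable (respectively, $\kappa$-Miller measurable) if for every perfect (respectively, $\kappa$-Miller) subtree $T\subseteq{}^{<\kappa}\kappa$ there is a perfect (respectively, $\kappa$-Miller) subtree $S\subseteq T$ such that either $[S]\subseteq A$ or $[S]\cap A=\emptyset$. *)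

(* Defs.v *)
From HB Require Import structures.
From mathcomp Require Import all_boot all_order all_classical.
From mathcomp Require Import wochoice topology.

Set Implicit Arguments.
Unset Strict Implicit.
Unset Printing Implicit Defensive.
Import Order.TTheory.

Local Open Scope classical_set_scope.
Local Open Scope card_scope.

(* Cardinals are initial ordinals: kappa is a well-ordered type K none of whose
   proper initial segments has the cardinality of K. An ordinal alpha < kappa
   is an element a : K, whose members are the x : K with x < a. The order is a
   bOrderType, \bot being the ordinal 0; this excludes only the cardinal 0. *)
Definition is_cardinal (d : Order.disp_t) (K : bOrderType d) : Prop :=
  well_order (<=%O : rel K) /\
  forall a : K, ~ ([set: K] #<= [set x : K | (x < a)%O]).

Definition card_lt (T U : Type) (A : set T) (B : set U) : Prop :=
  A #<= B /\ ~ (B #<= A).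

(* Functions from an ordinal below kappa into kappa. *)
Record bseq (d : Order.disp_t) (K : bOrderType d) := BSeq {
  blen : K ;
  bval : {x : K | (x < blen)%O} -> K
}.

(* kappa ^ (< kappa) = kappa *)
Definition card_exp_lt_self (d : Order.disp_t) (K : bOrderType d) : Prop :=
  [set: bseq K] #= [set: K].

(* kappa -> (kappa)^2_2; a colouring of the unordered pairs is given by
   the values c x y for x < y, the other values being irrelevant. *)
Definition weakly_compact (d : Order.disp_t) (K : bOrderType d) : Prop :=
  ~ countable [set: K] /\
  forall c : K -> K -> bool, exists (H : set K) (b : bool),
    H #= [set: K] /\
    forall x y, H x -> H y -> (x < y)%O -> c x y = b.

Section BoundedTopology.
Context {d : Order.disp_t} {K : bOrderType d}.
Implicit Types (s t u : bseq K) (x : K -> K).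

Definition bgraph s : set (K * K) :=
  [set p | exists h : (p.1 < blen s)%O, bval (exist _ p.1 h) = p.2].

Definition fgraph x : set (K * K) := [set p | x p.1 = p.2].

Definition restr x (a : K) : bseq K :=
  @BSeq d K a (fun z => x (sval z)).

Definition basic_open s : set (K -> K) := [set x | bgraph s `<=` fgraph x].

HB.instance Definition _ := gen_eqMixin (bseq K).
HB.instance Definition _ := gen_choiceMixin (bseq K).
HB.instance Definition _ := isPointed.Build (bseq K) (restr id \bot%O).

Lemma basic_open_cover : \bigcup_(s in [set: bseq K]) basic_open s = setT.
Proof.
apply/seteqP; split=> // x _; exists (restr x \bot%O) => // -[y z] [/= h <-].
by [].
Qed.

Lemma basic_open_join s t x : setT s -> setT t ->
  basic_open s x -> basic_open t x ->
  exists u, [/\ setT u, basic_open u x &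
                basic_open u `<=` basic_open s `&` basic_open t].
Proof.
have sub s' u y : (blen s' <= blen u)%O -> basic_open s' x ->
    u = restr x (blen u) -> basic_open u y -> basic_open s' y.
  move=> le_su s'x ux uy [a b] sab.
  have xab : x a = b := s'x (a, b) sab.
  apply: uy; rewrite ux; case: sab => /= h _.
  by exists (lt_le_trans h le_su).
move=> _ _ sx tx; exists (restr x (Order.max (blen s) (blen t))); split=> //.
  by move=> [a b] [/= h <-].
move=> y uy; split.
- by apply: sub uy => //=; rewrite le_max lexx.
- by apply: sub uy => //=; rewrite le_max lexx orbT.
Qed.

End BoundedTopology.

(* An alias of K -> K, carrying the bounded topology rather than the product
   topology. *)
Definition baire (d : Order.disp_t) (K : bOrderType d) : Type := K -> K.

HB.instance Definition _ (d : Order.disp_t) (K : bOrderType d) :=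
  gen_eqMixin (baire K).
HB.instance Definition _ (d : Order.disp_t) (K : bOrderType d) :=
  gen_choiceMixin (baire K).
HB.instance Definition _ (d : Order.disp_t) (K : bOrderType d) :=
  @isBaseTopological.Build (baire K) (bseq K) setT
    (@basic_open d K) (@basic_open_cover d K) (@basic_open_join d K).

Definition homeomorphic (X Y : topologicalType) : Prop :=
  exists (f : X -> Y) (g : Y -> X),
    [/\ cancel f g, cancel g f, continuous f & continuous g].

Section Definability.
Context {d : Order.disp_t} {K : bOrderType d}.
Implicit Types (A : set (baire K)).

Definition Sigma11 A : Prop :=
  exists C : set (baire K * baire K), closed C /\ A = fst @` C.

Definition Pi11 A : Prop := Sigma11 (~` A).

Definition kappa_compact A : Prop :=
  forall F : set (set (baire K)),
    (forall U, F U -> open U) -> A `<=` \bigcup_(U in F) U ->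
    exists G : set (set (baire K)),
      [/\ G `<=` F, card_lt G [set: K] & A `<=` \bigcup_(U in G) U].

Definition K_kappa A : Prop :=
  exists F : K -> set (baire K),
    (forall i, kappa_compact (F i)) /\ A = \bigcup_i F i.

Definition Hurewicz_dichotomy A : Prop :=
  (exists B, K_kappa B /\ A `<=` B) \/
  (exists C : set (baire K),
     [/\ closed C, C `<=` A & homeomorphic (set_type C) (baire K)]).

End Definability.

Section Trees.
Context {d : Order.disp_t} {K : bOrderType d}.
Implicit Types (T S : set (bseq K)) (s t u : bseq K) (A : set (baire K)).

Definition subtree T : Prop :=
  forall s t, bgraph s `<=` bgraph t -> T t -> T s.

Definition body T : set (baire K) := [set x | forall a : K, T (restr x a)].

(* The sequence of length a is (t i)_(i < a). *)
Definition superclosed T : Prop :=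
  forall (a : K) (t : K -> bseq K) u,
    (forall i, (i < a)%O -> T (t i)) ->
    (forall i j, (i < j)%O -> (j < a)%O -> bgraph (t i) `<=` bgraph (t j)) ->
    bgraph u = \bigcup_(i in [set i | (i < a)%O]) bgraph (t i) ->
    T u.

Definition immediate_successors T s : set (bseq K) :=
  [set u | [/\ T u, bgraph s `<` bgraph u &
    ~ exists v, bgraph s `<` bgraph v /\ bgraph v `<` bgraph u]].

(* N is a set whose cardinality bounds the splitting from below. *)
Definition splitting (I : Type) (N : set I) T : Prop :=
  forall t, T t -> exists s,
    [/\ T s, bgraph t `<=` bgraph s & N #<= immediate_successors T s].

Definition perfect_tree T : Prop :=
  [/\ T !=set0, subtree T, superclosed T & splitting `I_2 T].

Definition Miller_tree T : Prop :=
  [/\ T !=set0, subtree T, superclosed T & splitting [set: K] T].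

Definition tree_measurable (P : set (bseq K) -> Prop) A : Prop :=
  forall T, P T -> exists S,
    [/\ P S, S `<=` T & body S `<=` A \/ body S `&` A = set0].

Definition Sacks_measurable A : Prop := tree_measurable perfect_tree A.

Definition Miller_measurable A : Prop := tree_measurable Miller_tree A.

End Trees.

(* Main.v *)
(* Let [A] be Sigma^1_1 and [T] a tree with two-fold (resp. kappa-fold)
   splitting, and apply the Hurewicz dichotomy to the intersection of [A] with
   the closed set [[T]].

   If it is covered by kappa many kappa-compact sets, these are nowhere dense in
   [[T]]: a kappa-compact set is closed, so it would otherwise contain the
   branches of a subtree of [T], hence a copy of [^kappa 2] (resp.
   [^kappa kappa]), in which every kappa-sequence would accumulate. For
   [^kappa kappa] the constant sequences do not. For [^kappa 2], an accumulation
   point of the sequence [b |-> (a |-> c a b)] yields a homogeneous set for the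
   colouring [c], so kappa would be weakly compact. A fusion in [T] now avoids
   all the kappa-compact sets.

   Otherwise it contains a closed homeomorphic copy of [^kappa kappa], and the
   fusion is run in the domain [^(<kappa) kappa] of the homeomorphism [f]. When
   kappa is weakly compact, kappa-fold splitting of the images is available:
   if the branches in [f[N_t]] had fewer than kappa successors everywhere, then
   among the images of kappa many points of [N_t] that differ at the length of
   [t], a lexicographically monotone subsequence, given by the partition
   property, would converge. *)

From mathcomp Require Import all_boot all_order all_classical.
From mathcomp Require Import wochoice topology.
Require Import Defs.

Set Implicit Arguments.
Unset Strict Implicit.
Unset Printing Implicit Defensive.
Import Order.TTheory.

Local Open Scope classical_set_scope.
Local Open Scope card_scope.

(** * Cardinal comparison and agreement below a point *)

Lemma card_le_surj T U (A : set T) (B : set U) (g : U -> T) :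
  (forall x, A x -> exists2 y, B y & g y = x) -> A #<= B.
Proof.
move=> gs; apply: (@card_le_trans _ _ _ (g @` B)); last exact: card_image_le.
by apply: subset_card_le => x /gs[y By <-]; exists y.
Qed.

Lemma card_le_inj T U (A : set T) (B : set U) (f : T -> U) :
  (forall x, A x -> B (f x)) ->
  (forall x y, A x -> A y -> f x = f y -> x = y) -> A #<= B.
Proof.
move=> fAB fI; apply: (@card_le_trans _ _ _ (f @` A)).
  have /card_eqPle[] // : f @` A #= A.
  by apply: inj_card_eq => x y /set_mem Ax /set_mem Ay; apply: fI.
by apply: subset_card_le => _ [x Ax <-]; apply: fAB.
Qed.

Definition agree (d : Order.disp_t) (K : bOrderType d) (I : Type)
  (x y : K -> I) (a : K) : Prop := forall b, (b < a)%O -> x b = y b.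

Section Agree.
Context {d : Order.disp_t} {K : bOrderType d} {I : Type}.
Implicit Types (x y z : K -> I) (a b : K).

Lemma agree_refl x a : agree x x a. Proof. by []. Qed.

Lemma agree_sym x y a : agree x y a -> agree y x a.
Proof. by move=> xy b ba; rewrite xy. Qed.

Lemma agree_trans y x z a : agree x y a -> agree y z a -> agree x z a.
Proof. by move=> xy yz b ba; rewrite xy // yz. Qed.

Lemma agreeW a b x y : (b <= a)%O -> agree x y a -> agree x y b.
Proof. by move=> ba xy c cb; apply: xy; apply: lt_le_trans ba. Qed.

End Agree.

(** * Regularity of kappa *)

Section Cardinal.
Context {d : Order.disp_t} {K : bOrderType d}.
Hypothesis K_cardinal : is_cardinal K.

Lemma least (A : set K) : A !=set0 ->
  exists2 a, A a & forall b, A b -> (a <= b)%O.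
Proof.
case=> a Aa; have [wo _] := K_cardinal.
case: (wo (fun x => `[< A x >])) => [|z [[/asboolP Az zl] _]].
  by exists a; apply/asboolP.
by exists z => // b Ab; apply: zl; apply/asboolP.
Qed.

Lemma wf_ind (P : K -> Prop) :
  (forall a, (forall b, (b < a)%O -> P b) -> P a) -> forall a, P a.
Proof.
move=> IH a; apply: contrapT => nPa.
have [z nPz zl] := @least [set a | ~ P a] (ex_intro _ a nPa).
apply: nPz; apply: IH => b bz; apply: contrapT => nPb.
by have := zl b nPb; rewrite leNgt bz.
Qed.

Lemma ltK_wf : well_founded (fun a b : K => (a < b)%O).
Proof. by elim/wf_ind => a IH; constructor. Qed.

(** [F] receives a total function instead of one defined only below [a], which avoids dependent
    types; by the hypothesis [F a] ignores the values from [a] on. *)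
Lemma wf_rec (X : Type) (x0 : X) (F : K -> (K -> X) -> X) :
  (forall a s s', agree s s' a -> F a s = F a s') ->
  exists s, forall a, s a = F a s.
Proof.
move=> FE.
pose G a (r : forall b, (b < a)%O -> X) := F a (fun b =>
  if pselect (b < a)%O is left h then r b h else x0).
exists (Fix ltK_wf (fun=> X) G) => a; rewrite Fix_eq.
  by apply: FE => b ba; case: pselect.
move=> b r r' rr'; congr G; apply: functional_extensionality_dep => c.
by apply: functional_extensionality_dep.
Qed.

Hypothesis K_uncountable : ~ countable [set: K].
Hypothesis K_exp : card_exp_lt_self K.

(** If [a] were the greatest element, [K] would be the segment below [a] plus one point. An infinite
    set absorbs a point, so this segment would have the size of [K]. *)
Lemma no_max (a : K) : exists b, (a < b)%O.
Proof.
apply: contrapT => nb; have [_ /(_ a)] := K_cardinal; apply.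
have aM x : x != a -> (x < a)%O.
  move=> xa; rewrite lt_neqAle xa leNgt; apply/negP => ax.
  by apply: nb; exists x.
have iK : infinite_set ([set: K] `\` [set a]).
  apply: infinite_setD; last exact: finite_set1.
  by move=> /finite_set_countable.
pose A := [set: K] `\` [set a].
have [e] : $| {injfun [set: [set: nat]] >-> [set: A]} | by exact/card_leP/infiniteP.
pose f n : K := set_val (e (SigSub (mem_set (I : [set: nat] n)))).
have fa n : f n != a.
  by have [_ /eqP] := set_valP (e (SigSub (mem_set (I : [set: nat] n)))).
have fI : injective f.
  move=> m n /val_inj /(@inj _ _ _ e) => /(_ (mem_set I) (mem_set I)).
  by move=> /(congr1 set_val).
(* The shift [f 0 |-> a], [f n.+1 |-> f n], the identity elsewhere, maps the segment below [a] onto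
   [K]. *)
pose g x : K := if pselect (exists n, f n = x) is left h
  then (if projT1 (cid h) is n.+1 then f n else a) else x.
have gf n : g (f n) = if n is m.+1 then f m else a.
  by rewrite /g; case: pselect => [h|[]]; [case: cid => /= m /fI ->|exists n].
apply: (@card_le_surj _ _ _ _ g) => x _.
have [->|xa] := eqVneq x a; first by exists (f 0) => //=; rewrite ?gf //; apply: aM.
have [[n <-]|nx] := pselect (exists n, f n = x).
  by exists (f n.+1) => /=; rewrite ?gf //; apply: aM.
by exists x; [apply: aM|rewrite /g; case: pselect].
Qed.

(* An unbounded [g] on [a] would allow one to diagonalise against an enumeration
   of the functions from [a] to [K], as in Koenig's theorem. *)
Lemma regular (a : K) (g : K -> K) : exists m, forall x, (x < a)%O -> (g x < m)%O.
Proof.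
apply: contrapT => unb.
have {}unb c : exists2 x, (x < a)%O & (c < g x)%O.
  have [c' cc'] := no_max c; apply: contrapT => nx; apply: unb.
  exists c' => x xa; rewrite ltNge; apply/negP => cx; apply: nx.
  by exists x => //; apply: lt_le_trans cx.
have /card_eqPle[/pcard_surjP[e es] _] := K_exp.
(* The indices below [g x] are too few for the values at [x] to exhaust [K]. *)
have esc x : exists v, forall c (h : (x < blen (e c))%O),
    (c < g x)%O -> bval (exist _ x h) <> v.
  apply: contrapT => nv; have [_ /(_ (g x))] := K_cardinal; apply.
  apply: (@card_le_surj _ _ _ _ (fun c => if pselect (x < blen (e c))%O is left h
    then bval (exist _ x h) else c)) => v _.
  apply: contrapT => nc; apply: nv; exists v => c h cg vE; apply: nc.
  exists c => //; case: pselect => // h'.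
  by rewrite (Prop_irrelevance h' h).
have [h hP] := choice esc.
have [c _ ec] := es (restr h a) I; have [x xa cx] := unb c.
have := hP x c; rewrite ec => /(_ xa cx); exact.
Qed.

(** [f a] is chosen in [A] above all earlier values, which are bounded by regularity. *)
Lemma unbounded_enum (A : set K) :
  (forall a, exists2 x, A x & (a <= x)%O) ->
  exists f : K -> K, (forall a, A (f a)) /\ injective f.
Proof.
move=> unb; pose P (f : K -> K) a x := A x /\ forall b, (b < a)%O -> (f b < x)%O.
have [f fE] : exists f : K -> K, forall a, f a = xget \bot%O (P f a).
  apply: (wf_rec \bot%O (F := fun a f => xget \bot%O (P f a))) => a s s' ss'.
  congr (xget _ _); apply/seteqP; split=> x [Ax xP];
    by split=> // b ba; have := xP b ba; rewrite ss'.
have fP a : P f a (f a).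
  rewrite [X in P f a X]fE; have [m mP] := regular a f; have [x Ax mx] := unb m.
  apply: xgetPex; exists x; split=> // b /mP bm; exact: lt_le_trans mx.
exists f; split=> [a|x y fxy]; first by case: (fP a).
have [xy|yx|//] := ltgtP x y.
  by have [_ /(_ _ xy)] := fP y; rewrite fxy ltxx.
by have [_ /(_ _ yx)] := fP x; rewrite fxy ltxx.
Qed.

Lemma unbounded_card (A : set K) :
  (forall a, exists2 x, A x & (a <= x)%O) -> [set: K] #<= A.
Proof.
by move=> /unbounded_enum[f [Af fI]]; apply: (@card_le_inj _ _ _ _ f) => // x y _ _ /fI.
Qed.

Lemma card_unbounded (A : set K) : [set: K] #<= A ->
  forall a, exists2 x, A x & (a <= x)%O.
Proof.
move=> KA a; apply: contrapT => nx; have [_ /(_ a)] := K_cardinal; apply.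
apply: (card_le_trans KA); apply: subset_card_le => x Ax.
by rewrite /= ltNge; apply/negP => ax; apply: nx; exists x.
Qed.

Lemma strict_ge (f : K -> K) : (forall a b, (a < b)%O -> (f a < f b)%O) ->
  forall a, (a <= f a)%O.
Proof.
move=> fs; elim/wf_ind => a IH; rewrite leNgt; apply/negP => /[dup] fa /fs.
by rewrite ltNge IH.
Qed.

End Cardinal.
(** * The bounded topology *)

Section Sequences.
Context {d : Order.disp_t} {K : bOrderType d}.
Implicit Types (s t u : bseq K) (x y z : baire K) (a b : K).

Lemma bgraph_restr (x : K -> K) a p :
  bgraph (restr x a) p <-> (p.1 < a)%O /\ x p.1 = p.2.
Proof. by split=> [[h E]|[h E]]; [split|exists h]. Qed.

(** A total function restricting to [s], with arbitrary values past [blen s]. It reduces inclusion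
    of graphs to [agree]. *)
Definition bext s : baire K := fun b =>
  if pselect (b < blen s)%O is left h then bval (exist _ b h) else b.

Lemma bextK s : restr (bext s) (blen s) = s.
Proof.
case: s => a v; rewrite /restr /=; congr BSeq; apply/funext => -[b h] /=.
rewrite /bext; case: pselect => //= h'; by rewrite (Prop_irrelevance h' h).
Qed.

Lemma bgraph_restr_sub (x y : K -> K) a b :
  bgraph (restr x a) `<=` bgraph (restr y b) <-> (a <= b)%O /\ agree x y a.
Proof.
split=> [sub|[ab xy] p /bgraph_restr[pa E]]; last first.
  by apply/bgraph_restr; rewrite -xy //; split=> //; apply: lt_le_trans ab.
have sub' c : (c < a)%O -> (c < b)%O /\ y c = x c.
  by move=> ca; apply/(bgraph_restr y b (c, x c))/sub/bgraph_restr.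
split=> [|c /sub'[]//]; rewrite leNgt; apply/negP => /sub'[].
by rewrite ltxx.
Qed.

Lemma eq_restr (x y : K -> K) a : restr x a = restr y a <-> agree x y a.
Proof.
split=> [xy|xy]; last by congr BSeq; apply/funext => -[b h]; apply: xy.
have [_ //] : (a <= a)%O /\ agree x y a by apply/bgraph_restr_sub; rewrite xy.
Qed.

Lemma blen_sub s t : bgraph s `<=` bgraph t -> (blen s <= blen t)%O.
Proof. by rewrite -(bextK s) -(bextK t) => /bgraph_restr_sub[]. Qed.

Lemma bgraph_sub_eq s t : bgraph s `<=` bgraph t -> (blen t <= blen s)%O -> s = t.
Proof.
rewrite -(bextK s) -(bextK t) /= => /bgraph_restr_sub[le st] ge.
have E : blen s = blen t by apply/eqP; rewrite eq_le le.
by move: st; rewrite E => /eq_restr.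
Qed.

Lemma bgraph_proper s t : bgraph s `<=` bgraph t -> (blen s < blen t)%O ->
  bgraph s `<` bgraph t.
Proof. by move=> st lt; split=> // /blen_sub; rewrite leNgt lt. Qed.

Lemma proper_blen s t : bgraph s `<` bgraph t -> (blen s < blen t)%O.
Proof.
move=> [st ts]; rewrite lt_neqAle blen_sub // andbT; apply/eqP => E.
by apply: ts; rewrite (bgraph_sub_eq st) // E.
Qed.

Lemma basic_open_restr (x : K -> K) a y : basic_open (restr x a) y <-> agree x y a.
Proof.
split=> [xy b ba|xy [b c] /bgraph_restr[/= ba <-]]; last by rewrite /fgraph /= xy.
by rewrite (xy (b, x b)) //; apply/bgraph_restr.
Qed.

Lemma basic_openP s y : basic_open s y <-> agree (bext s) y (blen s).
Proof. by rewrite -{1}(bextK s); apply: basic_open_restr. Qed.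

Lemma basic_open_restrP s y : basic_open s y <-> restr y (blen s) = s.
Proof.
rewrite basic_openP -eq_restr bextK; split=> //.
Qed.

Lemma basic_open_sub s t : bgraph s `<=` bgraph t -> basic_open t `<=` basic_open s.
Proof. by move=> st x tx p /st /tx. Qed.

Lemma open_basic s : open (basic_open s : set (baire K)).
Proof.
by exists [set s] => //; rewrite bigcup_set1.
Qed.

Lemma nbhs_agree x (A : set (baire K)) :
  nbhs x A <-> exists a, forall z, agree x z a -> A z.
Proof.
rewrite nbhsE; split=> [[B [[D _ <-] [s Ds xs]] BA]|[a aA]].
  exists (blen s) => z xz; apply: BA; exists s => //.
  by apply/basic_openP; apply: agree_trans xz; apply/basic_openP.
exists (basic_open (restr x a)); first split.
- exact: open_basic.
- exact/basic_open_restr/agree_refl.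
- by move=> z /basic_open_restr; apply: aA.
Qed.

Lemma closed_agree (C : set (baire K)) x : closed C ->
  (forall a, exists2 z, C z & agree x z a) -> C x.
Proof.
move=> clC xC; apply: clC => B /nbhs_agree[a aB].
by have [z Cz xz] := xC a; exists z; split=> //; apply: aB.
Qed.

Lemma closed_body (T : set (bseq K)) : closed (body T : set (baire K)).
Proof.
move=> x xT a; have /xT[z [Tz xz]] : nbhs x (basic_open (restr x a)).
  by apply/nbhs_agree; exists a => z xz; apply/basic_open_restr.
by move: xz => /basic_open_restr/eq_restr ->.
Qed.

Lemma Sigma11_setI (A C : set (baire K)) :
  Sigma11 A -> closed C -> Sigma11 (A `&` C).
Proof.
move=> [B [clB ->]] clC; exists (B `&` fst @^-1` C); split.
  apply: closedI => //; apply: preimage_closed clC => x _.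
  exact: cvg_fst.
apply/seteqP; split=> [_ [[p Bp <-] Cp]|_ [p [Bp Cp] <-]]; first by exists p.
by split=> //; exists p.
Qed.

End Sequences.
(** Treats both kinds of trees at once: [I] is [bool] for perfect trees and [K] for Miller trees. *)
Definition split_tree (d : Order.disp_t) (K : bOrderType d) (I : Type)
  (T : set (bseq K)) : Prop :=
  [/\ T !=set0, subtree T, superclosed T & splitting [set: I] T].

(* [h] is the branch map of a copy of the tree [I^(<K)]: the values of [y]
   below [b] determine a node of length [l y b], at which the branch [h y]
   turns in a direction coding [y b]. *)
Definition scheme (d : Order.disp_t) (K : bOrderType d) (I : Type)
    (h : (K -> I) -> baire K) (l : (K -> I) -> K -> K) : Prop :=
  forall y y' b, agree y y' b ->
  [/\ l y b = l y' b, agree (h y) (h y') (l y b) &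
      (y b = y' b <-> h y (l y b) = h y' (l y b))].

Section RegularCardinal.
Context {d : Order.disp_t} {K : bOrderType d}.
Hypothesis K_cardinal : is_cardinal K.
Hypothesis K_uncountable : ~ countable [set: K].
Hypothesis K_exp : card_exp_lt_self K.
Implicit Types (s t u : bseq K) (x z : baire K) (a b c e : K).

Let wf_ind := wf_ind K_cardinal.
Let least := least K_cardinal.
Let no_max := no_max K_cardinal K_uncountable.
Let regular := regular K_cardinal K_uncountable K_exp.

Lemma succ_ex a : exists2 c, (a < c)%O & forall b, (b < c)%O -> (b <= a)%O.
Proof.
have [c ac cl] := least (no_max a); exists c => // b.
by rewrite !ltNge; apply: contraNT; rewrite -ltNge; apply: cl.
Qed.

(** * Accumulation points *)

(** Otherwise the open sets that the sequence avoids from some index on cover [C]. A subcover still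
    contains every [z a], so these indices are unbounded over it, and it has size at least kappa. *)
Lemma accumulation (C : set (baire K)) (z : K -> baire K) :
  kappa_compact C -> (forall b, C (z b)) ->
  exists2 x, C x & forall a c, exists2 b, (c <= b)%O & agree x (z b) a.
Proof.
move=> cC Cz; apply: contrapT => nx.
pose late (U : set (baire K)) c := forall b, (c <= b)%O -> ~ U (z b).
have [U [oU _]|x Cx|G [GF [_ Glt] CG]] := cC [set U | open U /\ exists c, late U c].
- by [].
- apply: contrapT => nU; apply: nx; exists x => // a c.
  apply: contrapT => nb; apply: nU; exists (basic_open (restr x a)).
    split; first exact: open_basic.
    by exists c => b cb /basic_open_restr xb; apply: nb; exists b.
  exact/basic_open_restr/agree_refl.
pose g U := xget \bot%O (late U).
apply: Glt; apply: card_le_trans (card_image_le g G).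
apply: unbounded_card => // a.
have [U GU Uz] := CG _ (Cz a); exists (g U); first by exists U.
have [_ Uc] := GF _ GU; rewrite leNgt; apply/negP => /ltW ga.
by have /(_ _ ga) := xgetPex \bot%O Uc.
Qed.

(** Compact sets are closed: points of [C] agreeing with [x] below ever larger [a] can only
    accumulate at [x]. *)
Lemma kappa_compact_agree (C : set (baire K)) x : kappa_compact C ->
  (forall a, exists2 z, C z & agree x z a) -> C x.
Proof.
move=> cC /(_ _)/cid2 xC; pose z a := projT1 (xC a).
have zC a : C (z a) /\ agree x (z a) a by rewrite /z; case: (xC a).
have [y Cy yz] := accumulation cC (fun a => proj1 (zC a)).
suff -> : x = y by [].
apply/funext => a; have [a' aa'] := no_max a; have [b ab yb] := yz a' a'.
rewrite (yb a) //; apply: (agreeW ab (proj2 (zC b))) => //.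
Qed.

(** [x] is built coordinate by coordinate: regularity gives one index past which all coordinates
    below [a] have settled, and the hypothesis then settles coordinate [a]. *)
Lemma eventual_limit (H : set K) (z : K -> baire K) :
  (forall v a, (exists e, forall b, (e <= b)%O -> H b -> agree v (z b) a) ->
    exists w e, forall b, (e <= b)%O -> H b -> z b a = w) ->
  exists x, forall a, exists e, forall b, (e <= b)%O -> H b -> agree x (z b) a.
Proof.
move=> step.
pose P a w := exists e, forall b, (e <= b)%O -> H b -> z b a = w.
pose x : baire K := fun a => xget \bot%O (P a); exists x.
have gather a : (forall c, (c < a)%O -> P c (x c)) ->
    exists e, forall b, (e <= b)%O -> H b -> agree x (z b) a.
  move=> Pc; have /choice[f fP] c : exists e, (c < a)%O ->
      forall b, (e <= b)%O -> H b -> z b c = x c.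
    by have [/Pc[e]|ca] := boolP (c < a)%O; [exists e|exists c].
  have [m mP] := regular a f; exists m => b mb Hb c ca; symmetry.
  by apply: fP => //; apply: le_trans mb; apply/ltW/mP.
have Px a : P a (x a).
  elim/wf_ind: a => a IH; have [w Pw] := step _ _ (gather a IH).
  exact: (xgetPex \bot%O (ex_intro (P a) w Pw)).
by move=> a; apply: gather => c _; apply: Px.
Qed.

(* Along a subsequence that is monotone for the lexicographic order, every
   coordinate is eventually constant. *)
Lemma weakly_compact_accumulation (z : K -> baire K) : weakly_compact K ->
  (forall v a, exists m, forall b, agree v (z b) a -> (z b a < m)%O) ->
  exists x, forall a c, exists2 b, (c <= b)%O & agree x (z b) a.
Proof.
move=> [_ WC] bnd.
pose lex i j := exists2 l, agree (z i) (z j) l & (z i l < z j l)%O.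
have [H [o [HK Ho]]] := WC (fun i j => `[< lex i j >]).
have /card_unbounded - /(_ K_cardinal) Hu : [set: K] #<= H.
  by have /card_eqPle[] := HK.
suff [x xP] : exists x, forall a, exists e,
    forall b, (e <= b)%O -> H b -> agree x (z b) a.
  exists x => a c; have [e eP] := xP a; have [b Hb bm] := Hu (Order.max c e).
  by move: bm; rewrite ge_max => /andP[cb eb]; exists b => //; apply: eP.
apply: eventual_limit => v a [e eP].
have [m mP] := bnd v a.
have agr b b' : (e <= b)%O -> (e <= b')%O -> H b -> H b' -> agree (z b) (z b') a.
  move=> eb eb' Hb Hb'; apply: agree_trans (eP _ eb' Hb').
  exact: agree_sym (eP _ eb Hb).
(* Colour [false]: past [e] the values at [a] are non-increasing along [H], so they settle at their
   minimum. *)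
case: o Ho => Ho; last first.
  have mono b b' : (e <= b)%O -> (b < b')%O -> H b -> H b' -> (z b' a <= z b a)%O.
    move=> eb bb' Hb Hb'; rewrite leNgt; apply/negP => lt.
    have /asboolP[] := negbT (Ho b b' Hb Hb' bb'); exists a => //.
    by apply: agr => //; apply/ltW/(le_lt_trans eb).
  have [|w [b0 [Hb0 eb0] <-] wl] :=
    @least [set w | exists2 b, H b /\ (e <= b)%O & z b a = w].
    by have [b Hb eb] := Hu e; exists (z b a), b.
  exists (z b0 a), b0 => b b0b Hb; have [->//|ne] := eqVneq b b0.
  apply/eqP; rewrite eq_le mono ?wl // ?lt_neqAle 1?eq_sym ?ne //.
  by exists b => //; split=> //; apply: le_trans b0b.
have mono b b' : (e <= b)%O -> (b <= b')%O -> H b -> H b' -> (z b a <= z b' a)%O.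
  move=> eb; rewrite le_eqVlt => /predU1P[->//|bb'] Hb Hb'.
  have /asboolP[l agl ltl] := Ho b b' Hb Hb' bb'.
  have [la|al|<-] := ltgtP l a; last exact: ltW.
    move: ltl; rewrite (agr b b') ?ltxx //.
    by apply/ltW/(le_lt_trans eb).
  by rewrite (agl a).
(* Colour [true]: the values at [a] are non-decreasing and below [m]. Unless they settle, each [w]
   is avoided from some index [g w] on; past a common bound of the [g w] with [w < m] no value
   remains. *)
apply: contrapT => nw.
have /choice[g gP] w : exists c, forall b, (c <= b)%O -> (e <= b)%O -> H b -> z b a <> w.
  have [[b [eb Hb] bw]|nb] := pselect (exists2 b, (e <= b)%O /\ H b & z b a = w).
    have [b1 [bb1 Hb1] b1w] : exists2 b1, (b <= b1)%O /\ H b1 & z b1 a <> w.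
      apply: contrapT => nb1; apply: nw; exists w, b => b' bb' Hb'.
      by apply: contrapT => ne; apply: nb1; exists b'.
    exists b1 => b2 b12 eb2 Hb2 E; apply: b1w; apply/eqP; rewrite eq_le.
    by rewrite -{1}E mono ?(le_trans eb) // -bw mono.
  by exists e => b _ eb Hb bw; apply: nb; exists b.
have [M MP] := regular m g.
have [b Hb] := Hu (Order.max M e); rewrite ge_max => /andP[Mb eb].
apply: (gP (z b a) b) => //; apply/ltW/(lt_le_trans _ Mb)/MP/mP.
exact: eP.
Qed.

(** * Schemes and the trees they generate *)

Section Scheme.
Context {I : Type} {i0 i1 : I}.
Hypothesis i01 : i0 <> i1.
Implicit Types (y : K -> I).

Definition subst y b i : K -> I := fun c => if c == b then i else y c.

Lemma subst_agree y b i : agree y (subst y b i) b.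
Proof. by move=> c; rewrite /subst lt_neqAle => /andP[/negPf ->]. Qed.

Arguments subst_agree : clear implicits.

Lemma substE y b i : subst y b i b = i. Proof. by rewrite /subst eqxx. Qed.

Section SchemeTree.
Context {h : (K -> I) -> baire K} {l : (K -> I) -> K -> K}.
Hypothesis hl : scheme h l.

(** Alter [y] at [c] only. The two branches still agree up to and including [l y b], but they differ
    at [l y c]. *)
Lemma scheme_lt y b c : (b < c)%O -> (l y b < l y c)%O.
Proof.
move=> bc; have [i iy] : exists i, y c <> i.
  have [E|] := pselect (y c = i0); last by exists i0.
  by exists i1; rewrite E.
have [_ _ nE] := hl (subst_agree y c i).
have [_ agl E] := hl (agreeW (ltW bc) (subst_agree y c i)).
rewrite ltNge; apply/negP => le; apply: iy.
rewrite -[RHS](substE y c i); apply/nE.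
move: le; rewrite le_eqVlt => /predU1P[->|/agl //].
by apply/E; apply: subst_agree.
Qed.

Lemma scheme_ge y b : (b <= l y b)%O.
Proof. by apply: (strict_ge K_cardinal (f := l y)) => c e; apply: scheme_lt. Qed.

(** Recursion reads [y a] off a branch that takes the turns already chosen and follows [x] through
    its [a]-th turn; when there is none, [i0] serves. So [h y] follows [x] for as long as any branch
    does. *)
Lemma scheme_retract x : exists y, forall e,
  (exists y', forall e', (e' <= e)%O -> h y' e' = x e') -> h y e = x e.
Proof.
pose P y a := [set i | exists y', [/\ agree y' y a, y' a = i &
  forall e', (e' <= l y' a)%O -> h y' e' = x e']].
have [y yE] : exists y, forall a, y a =
    if pselect (exists i, P y a i) is left w then projT1 (cid w) else i0.
  apply: (wf_rec K_cardinal i0 (F := fun a y =>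
    if pselect (exists i, P y a i) is left w then projT1 (cid w) else i0)).
  move=> a s s' ss'; suff -> : P s a = P s' a by [].
  apply/seteqP; split=> i [y' [ag]]; exists y'; split=> //.
    exact: agree_trans ss'.
  exact: agree_trans (agree_sym ss').
exists y => e [y' y'x].
(* Both [y'] and the witness chosen at [b] follow [x] through level [l y b], hence they take the
   same turn there. *)
have follow b : (l y b <= e)%O -> y' b = y b.
  elim/wf_ind: b => b IH be.
  have ag : agree y' y b.
    by move=> c cb; apply: IH => //; apply: le_trans be; apply/ltW/scheme_lt.
  have w : exists i, P y b i.
    exists (y' b), y'; split=> // e'; have [-> _ _] := hl ag => le.
    by apply: y'x; apply: le_trans be.
  move: (yE b); case: pselect => // w'; case: cid => /= i [y2 [ag2 <- y2x]] yb.
  have [lE _ E2] := hl (agree_trans ag2 (agree_sym ag)).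
  have [lE' _ _] := hl ag2.
  by rewrite yb; symmetry; apply/E2; rewrite y2x // y'x // lE'.
have [|b eb bl] := @least [set b | (e < l y b)%O].
  have [c ec] := no_max e; exists c; apply: lt_le_trans ec _; exact: scheme_ge.
have ag : agree y y' b.
  move=> c cb; symmetry; apply: follow; rewrite leNgt; apply/negP => /bl.
  by rewrite leNgt cb.
by have [_ /(_ _ eb) -> _] := hl ag; apply: y'x.
Qed.

Definition scheme_tree : set (bseq K) := [set s | exists y, basic_open s (h y)].

(** The range of [h] is closed: [scheme_retract] finds a single branch that follows [x] at every
    coordinate. *)
Lemma body_scheme_tree x : body scheme_tree x -> exists y, h y = x.
Proof.
move=> xS; have [y yP] := scheme_retract x; exists y; apply/funext => e.
apply: yP; have [c ec] := no_max e; have [y' /basic_open_restr xy'] := xS c.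
by exists y' => e' e'e; rewrite xy' //; apply: le_lt_trans ec.
Qed.

Lemma scheme_tree_split : split_tree I scheme_tree.
Proof.
split.
- by exists (restr (h (fun=> i0)) \bot%O), (fun=> i0); apply/basic_open_restr.
- by move=> s t st [y ty]; exists y; apply: basic_open_sub ty.
(* Each coordinate of [u] lies in some [t i], hence on a branch of the scheme; [scheme_retract]
   replaces these branches by a single one. *)
- move=> a t u tS tC uE; have [y yP] := scheme_retract (bext u).
  exists y; apply/basic_openP => e eu; symmetry; apply: yP.
  have : bgraph u (e, bext u e) by rewrite -{1}(bextK u); apply/bgraph_restr.
  rewrite uE => -[i ia [/= ei _]]; have [y' /basic_openP y'P] := tS i ia.
  exists y' => e' e'e; rewrite -y'P; last exact: le_lt_trans ei.
  have : bgraph (t i) `<=` bgraph u by rewrite uE => p tp; exists i.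
  rewrite -{1}(bextK u) -{1}(bextK (t i)) => /bgraph_restr_sub[_]; apply.
  exact: le_lt_trans ei.
(* This [b] puts the turning level [l y b] at or above the end of [t]; changing [y] at [b] gives the
   successors there. *)
- move=> t [y ty]; pose b := blen t.
  have [c lc cl] := succ_ex (l y b).
  exists (restr (h y) (l y b)); split.
  + by exists y; apply/basic_open_restr.
  + rewrite -{1}(bextK t); apply/bgraph_restr_sub; split; first exact: scheme_ge.
    exact/basic_openP.
  pose f i := restr (h (subst y b i)) c.
  have sub i : bgraph (restr (h y) (l y b)) `<=` bgraph (f i).
    apply/bgraph_restr_sub; split; first exact: ltW.
    by have [] := hl (subst_agree y b i).
  apply: (@card_le_inj _ _ _ _ f) => [i _|i j _ _ /eq_restr ag].
    split.
    * by exists (subst y b i); apply/basic_open_restr.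
    * exact: bgraph_proper.
    * move=> [v [/proper_blen v1 /proper_blen /cl]].
      by rewrite leNgt v1.
  have agb k : agree y (subst y b k) b by exact: subst_agree.
  have [_ _] := hl (agree_trans (agree_sym (agb i)) (agb j)).
  rewrite !substE => ->; apply: ag.
  by have [<- _ _] := hl (agb i).
Qed.

End SchemeTree.
End Scheme.
(** * Fusion *)

Lemma bgraph_fun s b c e : bgraph s (b, c) -> bgraph s (b, e) -> c = e.
Proof. by rewrite -(bextK s) => /bgraph_restr[_ /= <-] /bgraph_restr[]. Qed.

(** By regularity the lengths are bounded below kappa; their supremum [L] is the length of the
    union, since every [b < L] lies in the domain of some [t i]. *)
Lemma chain_union a (t : K -> bseq K) :
  (forall i j, (i < j)%O -> (j < a)%O -> bgraph (t i) `<=` bgraph (t j)) ->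
  exists u, bgraph u = \bigcup_(i in [set i | (i < a)%O]) bgraph (t i).
Proof.
move=> tC.
have [m mP] := regular a (fun i => blen (t i)).
have [|L LP Ll] := @least [set L | forall i, (i < a)%O -> (blen (t i) <= L)%O].
  by exists m => i /mP/ltW.
pose V b c := exists2 i, (i < a)%O & bgraph (t i) (b, c).
have Vfun b c c' : V b c -> V b c' -> c = c'.
  move=> [i ia tc] [j ja tc']; have [ij|ji|ij] := ltgtP i j.
  - by apply: bgraph_fun tc'; apply: tC tc.
  - by apply: bgraph_fun tc _; apply: tC tc'.
  - by rewrite ij in tc; apply: bgraph_fun tc'.
exists (restr (fun b => xget \bot%O (V b)) L); apply/seteqP; split=> [[b c]|[b c]].
  move=> /bgraph_restr[/= bL <-]; suff [v Vv] : exists v, V b v.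
    have [i ia tb] := xgetPex \bot%O (ex_intro (V b) v Vv); by exists i.
  apply: contrapT => nV; move: bL; rewrite ltNge => /negP; apply.
  apply: Ll => i ia; rewrite leNgt; apply/negP => bt; apply: nV.
  by exists (bext (t i) b), i => //; rewrite -{1}(bextK (t i)); apply/bgraph_restr.
move=> [i ia tb]; apply/bgraph_restr; split=> /=.
  by apply: lt_le_trans (LP i ia); case: tb.
have Vc : V b c by exists i.
by apply: (Vfun b _ _ _ Vc); apply: (xgetPex \bot%O (ex_intro (V b) c Vc)).
Qed.

(** One fusion step: the nodes [q i] force the requirement [D], and the images of their branches
    split at level [l]. [f] is the identity for a fusion in a tree, and a closed embedding, with [T]
    full, for a fusion in its domain. *)
Definition splits_at (I : Type) (T : set (bseq K)) (f : baire K -> baire K)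
    (D : set (baire K)) t (r : K * (I -> bseq K) * (I -> K)) : Prop :=
  let: (l, q, v) := r in
  [/\ injective v,
      forall i, [/\ T (q i), bgraph t `<=` bgraph (q i) & (blen t < blen (q i))%O],
      forall i z, body T z -> basic_open (q i) z -> D z /\ f z l = v i &
      forall i j z z', body T z -> body T z' -> basic_open (q i) z ->
        basic_open (q j) z' -> agree (f z) (f z') l].

(* The fusion argument: [f] sends the branches of a copy of [I^(<K)] inside [T]
   to the branches of a copy of [I^(<K)], the requirement [D b] being met at
   the [b]-th level. *)
Lemma fusion (I : Type) (T : set (bseq K)) (f : baire K -> baire K)
    (D : K -> set (baire K)) t0 :
  subtree T -> superclosed T -> T t0 ->
  (forall b t, T t -> exists r : K * (I -> bseq K) * (I -> K),
     splits_at T f (D b) t r) ->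
  exists (g : (K -> I) -> baire K) l, scheme (f \o g) l /\
    forall y, [/\ body T (g y), basic_open t0 (g y) & forall b, D b (g y)].
Proof.
move=> subT supT Tt0 H.
have /choice[r rP] (p : K * bseq K) : exists r : K * (I -> bseq K) * (I -> K),
    T p.2 -> splits_at T f (D p.1) p.2 r.
  have [/(H p.1)[r rP]|nT] := pselect (T p.2); first by exists r.
  by exists (\bot%O, fun=> t0, fun=> \bot%O).
pose q b t := (r (b, t)).1.2.
have qP b t i : T t ->
    [/\ T (q b t i), bgraph t `<=` bgraph (q b t i) & (blen t < blen (q b t i))%O].
  by move=> /(rP (b, t)) /=; rewrite /q; case: (r _) => -[l' q'] v' [_ + _ _].
(* Such a [u] may serve as stage [a] along [y]: it lies above the node chosen in direction [y b] at
   every earlier stage [b]. *)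
pose ub y a (s : K -> bseq K) u := [/\ T u, bgraph t0 `<=` bgraph u &
  forall b, (b < a)%O -> bgraph (q b (s b) (y b)) `<=` bgraph u].
have ubE (y y' : K -> I) a (s s' : K -> bseq K) : agree y y' a -> agree s s' a -> ub y a s = ub y' a s'.
  move=> yy' ss'; apply/seteqP; split=> u [Tu tu uP]; split=> // b ba.
    by rewrite -yy' // -ss' //; apply: uP.
  by rewrite yy' // ss' //; apply: uP.
have /choice[st stE] (y : K -> I) : exists s : K -> bseq K, forall a, s a = xget t0 (ub y a s).
  have [|s sE] := wf_rec K_cardinal (F := fun a (s : K -> bseq K) => xget t0 (ub y a s)) t0.
    by move=> a s s' ss'; rewrite (ubE y y a s s').
  by exists s.
have stP (y : K -> I) a : ub y a (st y) (st y a).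
  elim/wf_ind: a => a IH; rewrite [X in ub _ _ _ X]stE; apply: xgetPex.
  have Tst b : (b < a)%O -> T (st y b) by move=> /IH[].
  have stq b : (b < a)%O -> bgraph (st y b) `<=` bgraph (q b (st y b) (y b)).
    by move=> ba; have [] := qP b _ (y b) (Tst b ba).
  have chain i j : (i < j)%O -> (j < a)%O ->
      bgraph (q i (st y i) (y i)) `<=` bgraph (q j (st y j) (y j)).
    move=> ij ja; have [_ _ /(_ i ij) sub] := IH j ja.
    exact: subset_trans sub (stq j ja).
  (* At the first stage the union of the chain is empty and need not extend [t0], so [t0] itself
     serves. *)
  have [[c ca]|na] := pselect (exists c, (c < a)%O); last first.
    by exists t0; split=> // b ba; case: na; exists b.
  have [u uE] := chain_union chain; exists u; split.
  - apply: supT uE => // i ia; by have [] := qP i _ (y i) (Tst i ia).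
  - have [_ t0c _] := IH c ca; apply: (subset_trans t0c).
    by apply: (subset_trans (stq c ca)); rewrite uE => p qp; exists c.
  - by move=> b ba; rewrite uE => p qp; exists b.
(* [xget] depends only on the set it chooses from, so a stage depends only on the earlier values of
   [y]; [scheme] demands this coherence. *)
have st_eq (y y' : K -> I) a : agree y y' a -> st y a = st y' a.
  elim/wf_ind: a => a IH yy'; rewrite !stE; congr (xget _ _); apply: ubE => //.
  by move=> b ba; apply: IH => //; apply: agreeW yy'; exact: ltW.
have Tst y a : T (st y a) by have [] := stP y a.
have st_lt y a b : (a < b)%O -> bgraph (q a (st y a) (y a)) `<=` bgraph (st y b).
  by move=> ab; have [_ _] := stP y b; apply.
have st_sub y a b : (a < b)%O ->
    bgraph (st y a) `<=` bgraph (st y b) /\ (blen (st y a) < blen (st y b))%O.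
  move=> ab; have [_ sub lt] := qP a _ (y a) (Tst y a); split.
    exact: subset_trans sub (st_lt _ _ _ ab).
  exact: lt_le_trans lt (blen_sub (st_lt _ _ _ ab)).
have st_ge y a : (a <= blen (st y a))%O.
  by apply: (strict_ge K_cardinal (f := fun a => blen (st y a))) => b c /(st_sub y)[].
have [sc scP] := choice no_max.
(* Coordinate [e] is read at stage [sc e > e], whose length exceeds [e] by [st_ge]. *)
pose g y : baire K := fun e => bext (st y (sc e)) e.
have gst y a : basic_open (st y a) (g y).
  apply/basic_openP => e ea.
  have ag b c : (b <= c)%O -> (e < blen (st y b))%O ->
      bext (st y b) e = bext (st y c) e.
    rewrite le_eqVlt => /predU1P[->//|/(st_sub y)[+ _]] eb.
    by rewrite -{1}(bextK (st y b)) -{1}(bextK (st y c)) => /bgraph_restr_sub[_]; apply.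
  have es : (e < blen (st y (sc e)))%O by apply: lt_le_trans (st_ge y _).
  by have [/ag->//|/ltW/ag<-//] := leP a (sc e).
have gT y : body T (g y).
  move=> a; apply: subT (Tst y a); rewrite -(bextK (st y a)).
  apply/bgraph_restr_sub; split; first exact: st_ge.
  by apply: agreeW (st_ge y a) _; apply/agree_sym/basic_openP.
have gq y b : basic_open (q b (st y b) (y b)) (g y).
  exact: basic_open_sub (st_lt y b _ (scP b)) _ (gst y _).
exists g, (fun y b => (r (b, st y b)).1.1); split=> [y y' b yy'|y].
  have E := st_eq _ _ _ yy'; have := gq y' b; have := gq y b; rewrite -E.
  have := rP (b, st y b) (Tst y b); rewrite /q.
  case: (r _) => -[l' q'] v' /= [vI _ qv qag] yq y'q; split=> //.
    exact: qag yq y'q.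
  have [_ ->] := qv _ _ (gT y) yq; have [_ ->] := qv _ _ (gT y') y'q.
  by split=> [->|/vI].
split=> // [|b].
  by have [_ sub _] := stP y \bot%O; apply: basic_open_sub sub _ (gst y _).
have := gq y b; rewrite /q; have := rP (b, st y b) (Tst y b).
by case: (r _) => -[l' q'] v' /= [_ _ qv _] /(qv _ _ (gT y))[].
Qed.

(** * Compact sets are nowhere dense *)

Section Compact.
Context {I : Type} {i0 i1 : I}.
Hypothesis i01 : i0 <> i1.

(** Decoding by induction: for [c < a] the branches coincide at [l y c < l y a], which fixes the
    turn at [c]. *)
Lemma scheme_agree (h : (K -> I) -> baire K) l y y' a : scheme h l ->
  (forall e, (e <= l y a)%O -> h y e = h y' e) -> agree y y' a.
Proof.
move=> hl hy; elim/wf_ind => c IH ca.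
have ag : agree y y' c by move=> e ec; apply: IH => //; apply: lt_trans ca.
have [_ _ E] := hl _ _ _ ag; apply/E/hy/ltW.
exact: (scheme_lt i01 hl).
Qed.

(** An accumulation point of the branches [h (Y b)] is itself a branch, by [scheme_retract];
    decoding it yields [y]. *)
Lemma scheme_accumulation (C : set (baire K)) (h : (K -> I) -> baire K) l (Y : K -> K -> I) :
  kappa_compact C -> scheme h l -> (forall y, C (h y)) ->
  exists y, forall a c, exists2 b, (c <= b)%O & agree y (Y b) a.
Proof.
move=> cC hl Ch.
have [x _ xP] := accumulation cC (fun b => Ch (Y b)).
have [y yP] := scheme_retract i01 hl x.
have {yP} hy : h y = x.
  apply/funext => e; apply: yP; have [c ec] := no_max e.
  have [b _ xb] := xP c c; exists (Y b) => e' e'e.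
  by rewrite xb //; apply: le_lt_trans ec.
exists y => a c; have [c' lc] := no_max (l y a).
have [b cb xb] := xP c' c; exists b => //.
by apply: (scheme_agree hl) => e el; rewrite hy xb //; apply: le_lt_trans lc.
Qed.

(** An immediate successor is longer by exactly one, since otherwise a restriction of it would lie
    strictly between; only its value at [blen s] is free. *)
Lemma immediate_successor_inj (T : set (bseq K)) s u u' :
  immediate_successors T s u -> immediate_successors T s u' ->
  bext u (blen s) = bext u' (blen s) -> u = u'.
Proof.
have [c sc cl] := succ_ex (blen s).
have len v : immediate_successors T s v -> blen v = c /\ agree (bext s) (bext v) (blen s).
  move=> [_ sv nv]; have cv : (c <= blen v)%O.
    by rewrite leNgt; apply/negP => /cl; rewrite leNgt proper_blen.
  have ag : agree (bext s) (bext v) (blen s).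
    by have [] := sv; rewrite -{1}(bextK s) -{1}(bextK v) => /bgraph_restr_sub[].
  split=> //; apply/eqP; rewrite eq_le cv andbT leNgt; apply/negP => lt.
  apply: nv; exists (restr (bext v) c); split.
    rewrite -{1}(bextK s); apply: bgraph_proper => //.
    by apply/bgraph_restr_sub; split=> //; apply: ltW.
  rewrite -{2}(bextK v); apply: bgraph_proper => //.
  exact/bgraph_restr_sub.
move=> /len[uc su] /len[uc' su'] E.
rewrite -(bextK u) -(bextK u') uc uc'; apply/eq_restr => e /cl.
by rewrite le_eqVlt => /predU1P[->//|es]; rewrite -su // su'.
Qed.

(** Above [t] take a splitting node [s], and above each of [I] many successors of it a node that
    forces [E]; the level is [blen s]. *)
Lemma split_tree_splits_at (T : set (bseq K)) (E : set (baire K)) :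
  splitting [set: I] T ->
  (forall t, T t -> exists t', [/\ T t', bgraph t `<=` bgraph t' &
     forall z, body T z -> basic_open t' z -> E z]) ->
  forall t, T t -> exists r : K * (I -> bseq K) * (I -> K), splits_at T id E t r.
Proof.
move=> spl dense t Tt; have [s [Ts ts /pcard_leP[w]]] := spl t Tt.
have wP i : immediate_successors T s (w i) by apply: funS.
have wI : injective w.
  by move=> i j wij; apply: (@inj _ _ _ w) => //; apply: mem_set.
have /choice[q qP] i : exists t', [/\ T t', bgraph (w i) `<=` bgraph t' &
    forall z, body T z -> basic_open t' z -> E z].
  by apply: dense; have [] := wP i.
have sw i : bgraph s `<=` bgraph (w i) by have [_ []] := wP i.
have slt i : (blen s < blen (w i))%O by have [_ /proper_blen] := wP i.
have sq i : bgraph s `<=` bgraph (q i).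
  by have [_ wq _] := qP i; apply: subset_trans wq.
exists (blen s, q, fun i => bext (w i) (blen s)); split.
- by move=> i j /(immediate_successor_inj (wP i) (wP j)) /wI.
- move=> i; have [Tq wq _] := qP i; split=> //; first exact: subset_trans (sq i).
  exact: le_lt_trans (blen_sub ts) (lt_le_trans (slt i) (blen_sub wq)).
- move=> i z Tz qz; have [_ wq Ez] := qP i; split; first exact: Ez.
  by have /(basic_open_sub wq)/basic_openP -> := qz.
- move=> i j z z' _ _ /(basic_open_sub (sq i))/basic_openP sz.
  by move=> /(basic_open_sub (sq j))/basic_openP; apply: agree_trans; apply: agree_sym.
Qed.

(** Proved below for [I = K], and for [I = bool] when kappa is not weakly compact. *)
Hypothesis no_compact_scheme : forall (C : set (baire K)) h l,
  kappa_compact C -> scheme (I := I) h l -> ~ forall y, C (h y).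

(** Otherwise [C] meets every node of [T] above [t]. A fusion above [t], with trivial requirements,
    gives a scheme whose branches are limits of points of [C], so they lie in [C], which is
    closed. *)
Lemma kappa_compact_nowhere_dense (T : set (bseq K)) (C : set (baire K)) t :
  split_tree I T -> kappa_compact C -> T t ->
  exists t', [/\ T t', bgraph t `<=` bgraph t' &
    forall z, body T z -> basic_open t' z -> ~ C z].
Proof.
move=> [_ subT supT spl] cC Tt; apply: contrapT => nt.
have dense t' : T t' -> bgraph t `<=` bgraph t' ->
    exists2 z, basic_open t' z & C z.
  move=> Tt' tt'; apply: contrapT => nz; apply: nt; exists t'; split=> // z _ t'z Cz.
  by apply: nz; exists z.
have step s : T s -> exists s', [/\ T s', bgraph s `<=` bgraph s' &
    forall z, body T z -> basic_open s' z -> [set: baire K] z] by move=> Ts; exists s; split=> //; exact: subset_refl.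
have [g [l [gl gP]]] := fusion subT supT Tt (fun=> split_tree_splits_at spl step).
apply: (no_compact_scheme cC gl) => y.
have [Ty ty _] := gP y.
apply: kappa_compact_agree cC _ => a.
pose b := Order.max a (blen t).
have [z /basic_open_restr yz Cz] : exists2 z, basic_open (restr (g y) b) z & C z.
  apply: dense (Ty b) _; rewrite -(bextK t); apply/bgraph_restr_sub.
  by split; [rewrite le_max lexx orbT|apply/basic_openP].
by exists z => //; apply: agreeW yz; rewrite le_max lexx.
Qed.

End Compact.

(** With [Y b] constant of value [b], an accumulation point would equal [b] at [\bot] for
    unboundedly many [b]. *)
Lemma no_compact_scheme_kappa (C : set (baire K)) h l :
  kappa_compact C -> scheme (I := K) h l -> ~ forall y, C (h y).
Proof.
move=> cC hl Ch; have [k k0] := no_max \bot%O.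
have nk : \bot%O <> k by move=> E; move: k0; rewrite -E ltxx.
have [y yP] := scheme_accumulation nk (fun b _ => b) cC hl Ch.
have [c yc] := no_max (y \bot%O); have [b cb yb] := yP k c.
by move: yc; rewrite yb // ltNge cb.
Qed.

(** Recursion along an accumulation point [y] of the maps [col _ b] gives an increasing [f] such
    that the colour of a pair from its range is the value of [y] at the lower element; one of the
    two values occurs unboundedly often. *)
Lemma no_compact_scheme_bool (C : set (baire K)) h l : ~ weakly_compact K ->
  kappa_compact C -> scheme (I := bool) h l -> ~ forall y, C (h y).
Proof.
move=> nWC cC hl Ch; apply: nWC; split=> // col.
have ft : false <> true by [].
have [y yP] := scheme_accumulation ft (fun b a => col a b) cC hl Ch.
pose P (f : K -> K) a b := forall c, (c < a)%O -> (f c < b)%O /\ col (f c) b = y (f c).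
have [f fE] : exists f : K -> K, forall a, f a = xget \bot%O (P f a).
  apply: (wf_rec K_cardinal \bot%O (F := fun a f => xget \bot%O (P f a))) => a s s' ss'.
  by congr (xget _ _); apply/seteqP; split=> x xP c ca; have := xP c ca; rewrite ss'.
have fP a : P f a (f a).
  rewrite [X in P f a X]fE; apply: xgetPex; have [m mP] := regular a f.
  have [b mb yb] := yP m m; exists b => c /mP cm; split; first exact: lt_le_trans mb.
  by rewrite -yb.
have f_lt a b : (a < b)%O -> (f a < f b)%O by move=> /(fP b)[].
have f_ge := strict_ge K_cardinal f_lt.
have [o oP] : exists o, forall a, exists2 b, y (f b) = o & (a <= b)%O.
  apply: contrapT => no.
  have bnd o : exists a, forall b, y (f b) = o -> (b < a)%O.
    apply: contrapT => na; apply: no; exists o => a; apply: contrapT => nb.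
    apply: na; exists a => b yb; rewrite ltNge; apply/negP => ab; apply: nb.
    by exists b.
  have [a aP] := bnd false; have [b bP] := bnd true.
  have := aP (Order.max a b); have := bP (Order.max a b).
  rewrite !gt_max !ltxx /= andbF.
  by case: (y _) => [/(_ erefl)|_ /(_ erefl)].
exists (f @` [set b | y (f b) = o]), o; split.
  apply/card_eqPle; split; first exact: card_leT.
  apply: unbounded_card => // a; have [b yb ab] := oP a.
  by exists (f b); [exists b|apply: le_trans (f_ge b)].
move=> _ _ [a ya <-] [b yb <-] fab.
have [ab|ba|E] := ltgtP a b.
- by have [_ ->] := fP b a ab.
- by move: fab; rewrite ltNge ltW // f_lt.
- by move: fab; rewrite E ltxx.
Qed.

(** * Closed copies of the generalized Baire space *)

(** The second clause is continuity. The third is continuity of the inverse on the range, and it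
    includes injectivity. *)
Definition closed_embedding (f : baire K -> baire K) : Prop :=
  [/\ closed (range f),
      forall z a, exists b, forall z', agree z z' b -> agree (f z) (f z') a &
      forall z a, exists b, forall z', agree (f z) (f z') b -> agree z z' a].

Lemma homeomorphic_closed_embedding (C : set (baire K)) :
  closed C -> homeomorphic (set_type C) (baire K) ->
  exists f, closed_embedding f /\ range f = C.
Proof.
move=> clC [f [g [fK gK fc gc]]].
have rE : range (fun z => set_val (g z)) = C.
  apply/seteqP; split=> [_ [z _ <-]|x Cx]; first exact: set_valP.
  by exists (f (SigSub (mem_set Cx))) => //; rewrite fK.
exists (fun z => set_val (g z)); split=> //; split=> [|z a|z a]; first by rewrite rE.
  have /nbhs_agree[b bP] : nbhs z ((fun z => set_val (g z)) @^-1`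
      basic_open (restr (set_val (g z)) a)).
    have cont : {for z, continuous (set_val \o g : baire K -> baire K)}.
      by apply: continuous_comp; [apply: gc|apply: initial_continuous].
    apply: cont; apply/nbhs_agree; exists a => z' ag; exact/basic_open_restr.
  by exists b => z' /bP/basic_open_restr.
have : nbhs (g z) (f @^-1` basic_open (restr z a)).
  apply: fc; rewrite gK; apply/nbhs_agree; exists a => z' ag; exact/basic_open_restr.
(* Open sets of the subspace are traces of open sets [A] of the whole space. *)
rewrite nbhsE => -[_ [[A oA <-] Az] AB].
have /nbhs_agree[b bP] : nbhs (set_val (g z) : baire K) A.
  exact: open_nbhs_nbhs.
by exists b => z' /bP/AB; rewrite /= gK => /basic_open_restr.
Qed.

Definition extend t c : baire K := fun e => if (e < blen t)%O then bext t e else c.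

Lemma basic_open_extend t c : basic_open t (extend t c).
Proof. by apply/basic_openP => e et; rewrite /extend et. Qed.

Lemma extend_blen t c : extend t c (blen t) = c.
Proof. by rewrite /extend ltxx. Qed.

Definition splits_below (I : Type) (f : baire K -> baire K) t : Prop :=
  exists l (z : I -> baire K), [/\ forall i, basic_open t (z i),
    forall i j, agree (f (z i)) (f (z j)) l & injective (fun i => f (z i) l)].

(** By continuity a restriction of [z i] fixes the images up to and including level [l]; its length
    is at least [m], so that it properly extends [t]. *)
Lemma splits_below_splits_at (I : Type) f t :
  closed_embedding f -> splits_below I f t ->
  exists r : K * (I -> bseq K) * (I -> K), splits_at setT f setT t r.
Proof.
move=> [_ cf _] [l [z [tz zl zI]]]; have [k lk] := no_max l.
have /choice[b bP] i := cf (z i) k; have [m tm] := no_max (blen t).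
pose q i := restr (z i) (Order.max m (b i)).
have qP i z' : basic_open (q i) z' -> agree (f (z i)) (f z') k.
  move=> /basic_open_restr ag; apply: bP; apply: agreeW ag.
  by rewrite le_max lexx orbT.
have lt i : (blen t < blen (q i))%O by rewrite /= lt_max tm.
exists (l, q, fun i => f (z i) l); split=> // [i|i z' _ /qP ->//|i j z' z'' _ _ /qP zz' /qP zz''].
  split=> //; rewrite -{1}(bextK t); apply/bgraph_restr_sub.
  by split; [apply/ltW/lt|apply/basic_openP].
apply: agree_trans (agreeW (ltW lk) zz''); apply: agree_trans (zl i j).
exact/agree_sym/(agreeW (ltW lk)).
Qed.

(** Two points of [N_t] that differ at [blen t] have different images; [l] is the first place where
    these differ. *)
Lemma closed_embedding_splits_bool f t : closed_embedding f -> splits_below bool f t.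
Proof.
move=> [_ _ fi]; have [k k0] := no_max \bot%O.
pose z (i : bool) := extend t (if i then k else \bot%O).
have [|l lz ll] := @least [set l | f (z true) l != f (z false) l].
  apply: contrapT => nl; have [m tm] := no_max (blen t).
  have [b bP] := fi (z true) m.
  have /bP/(_ _ tm) : agree (f (z true)) (f (z false)) b.
    by move=> c _; apply: contrapT => ne; apply: nl; exists c; apply/eqP.
  by rewrite /z !extend_blen => E; move: k0; rewrite E ltxx.
have ag : agree (f (z true)) (f (z false)) l.
  move=> c cl; apply: contrapT => /eqP /ll; by rewrite leNgt cl.
exists l, z; split=> [i|i j|]; first exact: basic_open_extend.
  by case: i j => -[] //; apply: agree_sym.
by case=> -[] //= E; move: lz; rewrite /= E eqxx.
Qed.

Lemma closed_embedding_splits_kappa f t : weakly_compact K ->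
  closed_embedding f -> splits_below K f t.
Proof.
move=> WC [clf _ fi].
pose X v a := [set w | exists z, [/\ basic_open t z, agree v (f z) a & f z a = w]].
(* It is enough that the successors occurring at one node are unbounded. *)
suff [v [a /unbounded_enum]] : exists v a, forall b, exists2 w, X v a w & (b <= w)%O.
  move=> /(_ K_cardinal K_uncountable K_exp)[w [/choice[z zP] wI]].
  exists a, z; split=> [i|i j|i j].
  - by case: (zP i).
  - have [_ vi _] := zP i; have [_ vj _] := zP j.
    exact: agree_trans (agree_sym vi) vj.
  - by have [_ _ ->] := zP i; have [_ _ ->] := zP j => /wI.
apply: contrapT => nX.
have [|x xP] := weakly_compact_accumulation (z := fun i => f (extend t i)) WC.
  move=> v a; apply: contrapT => nm; apply: nX; exists v, a => b.
  apply: contrapT => nw; apply: nm; exists b => i vi; rewrite ltNge; apply/negP => bi.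
  apply: nw; exists (f (extend t i) a) => //; exists (extend t i); split=> //.
  exact: basic_open_extend.
have [z _ fz] : range f x.
  apply: closed_agree clf _ => a; have [b _ xb] := xP a \bot%O.
  by exists (f (extend t b)) => //; exists (extend t b).
(* [f z] is an accumulation point of the images, so by continuity of the inverse [z (blen t) = i]
   for arbitrarily large [i]. *)
have [m tm] := no_max (blen t); have [b bP] := fi z m.
have [c zc] := no_max (z (blen t)); have [i ci xi] := xP b c.
have /bP/(_ _ tm) : agree (f z) (f (extend t i)) b by rewrite fz.
by rewrite extend_blen => zi; move: zc; rewrite zi ltNge ci.
Qed.

(** * From the dichotomy to measurability *)

Lemma Sigma11_split_tree_measurable (I : Type) (i0 i1 : I) : i0 <> i1 ->
  (forall A : set (baire K), Sigma11 A -> Hurewicz_dichotomy A) ->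
  (forall (C : set (baire K)) h l, kappa_compact C -> scheme (I := I) h l ->
    ~ forall y, C (h y)) ->
  (forall f t, closed_embedding f -> splits_below I f t) ->
  forall A : set (baire K), Sigma11 A -> tree_measurable (split_tree I) A.
Proof.
move=> i01 HD ncs emb A SA T splT; have [[t0 Tt0] subT supT spl] := splT.
(* The initial segments of the branches of such a scheme form the tree sought. *)
suff [h [l [hl [Th hA]]]] : exists (h : (K -> I) -> baire K) l, scheme h l /\
    (forall y, body T (h y)) /\ ((forall y, A (h y)) \/ (forall y, ~ A (h y))).
  exists (scheme_tree (h := h)); split.
  - exact: (scheme_tree_split i01 hl).
  - by move=> s [y /basic_open_restrP <-]; apply: Th.
  - case: hA => hA; [left|right].
      by move=> x /(body_scheme_tree i01 hl)[y <-].
    by apply/seteqP; split=> // x [/(body_scheme_tree i01 hl)[y <-] /hA].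
have [[_ [[F [cF ->]] AF]]|[C [clC CA hC]]] :=
  HD _ (Sigma11_setI SA (@closed_body _ _ T)).
  (* Covered case: level [b] of the fusion avoids the compact set [F b]. *)
  have step b := split_tree_splits_at spl (E := ~` F b)
    (fun t Tt => kappa_compact_nowhere_dense ncs splT (cF b) Tt).
  have [g [l [gl gP]]] := fusion subT supT Tt0 step.
  exists g, l; split=> //; split=> [y|]; first by case: (gP y).
  right=> y Ay; have [Ty _ nF] := gP y.
  by have [b _ Fb] := AF _ (conj Ay Ty); apply: nF Fb.
have [f [fe fC]] := homeomorphic_closed_embedding clC hC.
(* Here the fusion runs in the full tree with trivial requirements; [t0] is just some node to start
   from. *)
have step (b : K) t (_ : setT t) := splits_below_splits_at fe (emb f t fe).
have [//|//|g [l [gl gP]]] :=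
  @fusion I setT f (fun=> setT) t0 _ _ Logic.I (fun b t Tt => step b t Tt).
have ATg y : (A `&` body T) (f (g y)) by apply: CA; rewrite -fC; exists (g y).
exists (f \o g), l; split=> //; split=> [y|]; first by case: (ATg y).
by left=> y; case: (ATg y).
Qed.

End RegularCardinal.

Lemma tree_measurable_setC (d : Order.disp_t) (K : bOrderType d)
    (P : set (bseq K) -> Prop) (A : set (baire K)) :
  tree_measurable P (~` A) -> tree_measurable P A.
Proof.
move=> mA T /mA[S [PS ST SA]]; exists S; split=> //.
case: SA => SA; [right|left]; first by apply/disjoints_subset.
by rewrite -(setCK A); apply/disjoints_subset.
Qed.

Lemma perfect_treeE (d : Order.disp_t) (K : bOrderType d) :
  @perfect_tree d K = split_tree bool.
Proof.
apply/funext => T; congr [/\ _, _, _ & _].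
suff E : `I_2 #= [set: bool].
  apply/propext; split=> spl t /spl[s [Ts ts le]]; exists s; split=> //.
    by rewrite -(card_le_eql E).
  by rewrite (card_le_eql E).
apply/card_eqPle; split.
  by apply: (@card_le_inj _ _ _ _ (fun n => n == 1%N)) => // -[|[|n]] [|[|m]].
by apply: (@card_le_inj _ _ _ _ nat_of_bool) => // -[] // [].
Qed.

Theorem theorem5p2 (d : Order.disp_t) (K : bOrderType d)
    (K_cardinal : is_cardinal K)
    (K_uncountable : ~ countable [set: K])
    (K_exp : card_exp_lt_self K)
    (HD : forall A : set (baire K), Sigma11 A -> Hurewicz_dichotomy A) :
  (~ weakly_compact K ->
     forall A : set (baire K), Sigma11 A \/ Pi11 A -> Sacks_measurable A) /\
  (weakly_compact K ->
     forall A : set (baire K), Sigma11 A \/ Pi11 A -> Miller_measurable A).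
Proof.
(* Tree measurability is invariant under complements, so [Pi11] sets reduce to [Sigma11] sets. *)
suff meas (P : set (bseq K) -> Prop) :
    (forall A : set (baire K), Sigma11 A -> tree_measurable P A) ->
    forall A : set (baire K), Sigma11 A \/ Pi11 A -> tree_measurable P A.
  split=> WC; apply: meas.
    rewrite perfect_treeE.
    apply: (@Sigma11_split_tree_measurable _ _ _ _ _ _ false true) => //.
      by move=> C h l; apply: no_compact_scheme_bool.
    by move=> f t; apply: closed_embedding_splits_bool.
  have [k k0] := no_max K_cardinal K_uncountable \bot%O.
  apply: (@Sigma11_split_tree_measurable _ _ _ _ _ _ \bot%O k) => //.
  - by move=> E; move: k0; rewrite -E ltxx.
  - by move=> C h l; apply: no_compact_scheme_kappa.
  - by move=> f t; apply: closed_embedding_splits_kappa.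
by move=> mP A [/mP//|/mP/tree_measurable_setC].
Qed.
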